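(* Let $\Lambda\colon L\times W\to[0,\infty]$ be a dissimilarity with $L$ finite and let $\varphi\colon L\to L$ be a parent function. Then the $(\Lambda,\varphi)$-restriction $R(\Lambda,\varphi)\colon L\to[0,\infty]$ is the minimal restriction function for $\Lambda$ relative to $\varphi$: it is a restriction function for $\Lambda$ relative to $\varphi$, and if $R$ is another restriction function for $\Lambda$ relative to $\varphi$, then $R(\Lambda,\varphi)(l)\le R(l)$ for every $l\in L$.
   Context: A dissimilarity $\Lambda$ consists of two sets $L$ and $W$ and a function $\Lambda\colon L\times W\to[0,\infty]$ (no further axioms). A function $\varphi\colon L\to L$ is a parent function if $\varphi^n(l)=l$ for some $n>0$ implies $\varphi(l)=l$. A function $R\colon L\to[0,\infty]$ is a restriction function for $\Lambda$ relative to a parent function $\varphi$ if: (1) for all $(l,w)\in L\times W$ with $\Lambda(l,w)<\Lambda(\varphi(l),w)$ we have $\Lambda(\varphi(l),w)\le R(l)$; (2) for every $l\in L$ we have $R(\varphi(l))\ge R(l)$; (3) if $\varphi(l)=l$, then $R(l)=\infty$. The $(\Lambda,\varphi)$-restriction $R(\Lambda,\varphi)\colon L\to[0,\infty]$ is defined as follows. For $l,l'\in L$ let $P(l,l')=\{\Lambda(l',w)\mid w\in W \text{ with } \Lambda(l,w)<\Lambda(l',w)\}$, and let $\rho(l,l')=\sup P(l,l')$ if $P(l,l')$ is non-empty and $\rho(l,l')=0$ if $P(l,l')=\emptyset$. Define $R'\colon L\to[0,\infty]$ by $R'(l)=\rho(l,\varphi(l))$ if $\varphi(l)\ne l$ and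 $R'(l)=\infty$ if $\varphi(l)=l$. For $l\in L$ let $D(l)$ be the set of descendants of $l$, that is, $l'\in D(l)$ if and only if there exists $m\ge0$ with $l=\varphi^m(l')$. Then $R(\Lambda,\varphi)(l)=\max_{l'\in D(l)}R'(l')$. *)

(* Defs.v *)
From HB Require Import structures.
From mathcomp Require Import all_boot all_order all_algebra.
From mathcomp Require Import all_classical all_reals all_analysis.

Set Implicit Arguments.
Unset Strict Implicit.
Unset Printing Implicit Defensive.

Import Order.TTheory GRing.Theory Num.Theory.

Local Open Scope classical_set_scope.
Local Open Scope ereal_scope.

(* [0, oo] is encoded as the nonnegative part of \bar R: nonnegativity is part
   of the definitions of dissimilarities and of restriction functions. *)
Definition is_dissimilarity (R : realType) (L W : Type)
    (Lam : L -> W -> \bar R) : Prop :=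
  forall l w, 0 <= Lam l w.

Definition is_parent_function (L : Type) (phi : L -> L) : Prop :=
  forall (l : L) (n : nat), (0 < n)%N -> iter n phi l = l -> phi l = l.

Record is_restriction_function (R : realType) (L W : Type)
    (Lam : L -> W -> \bar R) (phi : L -> L) (r : L -> \bar R) : Prop :=
  IsRestrictionFunction {
    restriction_ge0 : forall l, 0 <= r l;
    restriction_bound : forall l w,
      Lam l w < Lam (phi l) w -> Lam (phi l) w <= r l;
    restriction_mono : forall l, r l <= r (phi l);
    restriction_fixed : forall l, phi l = l -> r l = +oo
  }.

Definition jump_values (R : realType) (L W : Type)
    (Lam : L -> W -> \bar R) (l l' : L) : set (\bar R) :=
  [set Lam l' w | w in [set w | Lam l w < Lam l' w]].

(* The empty case is separate since ereal_sup set0 = -oo. *)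
Definition rho (R : realType) (L W : Type)
    (Lam : L -> W -> \bar R) (l l' : L) : \bar R :=
  if jump_values Lam l l' == set0 then 0 else ereal_sup (jump_values Lam l l').

Definition local_restriction (R : realType) (L : finType) (W : Type)
    (Lam : L -> W -> \bar R) (phi : L -> L) (l : L) : \bar R :=
  if phi l == l then +oo else rho Lam l (phi l).

Definition descendants (L : finType) (phi : L -> L) (l : L) : {set L} :=
  [set l' : L | `[< exists m : nat, l = iter m phi l' >]]%SET.

(* The maximum ranges over a nonempty set (l is a descendant of itself), so the
   default value -oo does not affect the result. *)
Definition restriction (R : realType) (L : finType) (W : Type)
    (Lam : L -> W -> \bar R) (phi : L -> L) (l : L) : \bar R :=
  \big[maxe/-oo]_(l' in descendants phi l) local_restriction Lam phi l'.

(* Main.v *)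
Require Import Defs.
From HB Require Import structures.
From mathcomp Require Import all_boot all_order all_algebra.
From mathcomp Require Import all_classical all_reals all_analysis.

(** Each value of the local restriction is forced at its own element: at [l] it
    is the least nonnegative bound of the jumps from [l] to its parent, or [+oo]
    at a fixed point ([local_restriction_le]).  A restriction function is
    moreover nondecreasing along [phi], so its value at [l] dominates whatever
    is forced at any descendant of [l].  The maximum over the descendants is
    therefore a lower bound of all restriction functions; it is itself a
    restriction function because an element is its own descendant
    ([local_restriction_le_restriction]) and because the descendants of [l] are
    among those of [phi l] ([descendants_parent]). *)

Import Order.TTheory.

Local Open Scope ereal_scope.

Lemma descendantsP (L : finType) (phi : L -> L) (l l' : L) :
  reflect (exists m, l = iter m phi l') (l' \in descendants phi l).
Proof. by rewrite inE; exact: asboolP. Qed.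

Lemma descendants_refl (L : finType) (phi : L -> L) (l : L) :
  l \in descendants phi l.
Proof. by apply/descendantsP; exists 0%N. Qed.

Lemma descendants_parent (L : finType) (phi : L -> L) (l l' : L) :
  l' \in descendants phi l -> l' \in descendants phi (phi l).
Proof. by case/descendantsP=> m ->; apply/descendantsP; exists m.+1. Qed.

Lemma le_jump_rho (R : realType) (L W : Type) (Lam : L -> W -> \bar R)
    (l l' : L) (w : W) :
  Lam l w < Lam l' w -> Lam l' w <= rho Lam l l'.
Proof.
move=> jump; have Pw : jump_values Lam l l' (Lam l' w) by exists w.
rewrite /rho; case: eqP => [P0|_]; first by rewrite P0 in Pw.
exact: ereal_sup_ubound.
Qed.

Lemma rho_le (R : realType) (L W : Type) (Lam : L -> W -> \bar R)
    (l l' : L) (x : \bar R) :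
    0 <= x -> (forall w, Lam l w < Lam l' w -> Lam l' w <= x) ->
  rho Lam l l' <= x.
Proof.
move=> x_ge0 xP; rewrite /rho; case: ifP => // _.
by apply: ge_ereal_sup => _ [w jump <-]; exact: xP.
Qed.

(** An empty set of jumps contributes [0]; otherwise some jump
    [0 <= Lam l w < Lam l' w] bounds the supremum from below. *)
Lemma rho_ge0 (R : realType) (L W : Type) (Lam : L -> W -> \bar R) (l l' : L) :
  is_dissimilarity Lam -> 0 <= rho Lam l l'.
Proof.
move=> Lam_ge0; have [P0|/set0P[_ [w jump _]]] := eqVneq (jump_values Lam l l') set0.
  by rewrite /rho P0 eqxx.
by apply: (le_trans (Lam_ge0 l' w)); exact: le_jump_rho.
Qed.

Lemma local_restriction_ge0 (R : realType) (L : finType) (W : Type)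
    (Lam : L -> W -> \bar R) (phi : L -> L) (l : L) :
  is_dissimilarity Lam -> 0 <= local_restriction Lam phi l.
Proof.
move=> Lam_ge0; rewrite /local_restriction; case: ifP => _; first exact: leey.
exact: rho_ge0.
Qed.

Lemma le_jump_local_restriction (R : realType) (L : finType) (W : Type)
    (Lam : L -> W -> \bar R) (phi : L -> L) (l : L) (w : W) :
  Lam l w < Lam (phi l) w -> Lam (phi l) w <= local_restriction Lam phi l.
Proof.
move=> jump; rewrite /local_restriction; case: ifP => _; first exact: leey.
exact: le_jump_rho.
Qed.

(** The three cases of the local restriction match three constraints on [r l]:
    its value [+oo] at a fixed point, its nonnegativity when there is no jump
    from [l] to [phi l], and the bound on the jumps otherwise. *)
Lemma local_restriction_le (R : realType) (L : finType) (W : Type)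
    (Lam : L -> W -> \bar R) (phi : L -> L) (r : L -> \bar R) (l : L) :
  is_restriction_function Lam phi r -> local_restriction Lam phi l <= r l.
Proof.
move=> rP; rewrite /local_restriction; case: eqP => [fix_l|_].
  by rewrite (restriction_fixed rP fix_l).
by apply: rho_le => [|w]; [exact: (restriction_ge0 rP)|exact: (restriction_bound rP)].
Qed.

Lemma restriction_function_descendants (R : realType) (L : finType) (W : Type)
    (Lam : L -> W -> \bar R) (phi : L -> L) (r : L -> \bar R) (l l' : L) :
    is_restriction_function Lam phi r -> l' \in descendants phi l ->
  r l' <= r l.
Proof.
move=> rP /descendantsP[m ->]; elim: m => //= m IHm.
by apply: (le_trans IHm); exact: (restriction_mono rP).
Qed.

Lemma local_restriction_le_restriction (R : realType) (L : finType) (W : Type)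
    (Lam : L -> W -> \bar R) (phi : L -> L) (l l' : L) :
  l' \in descendants phi l ->
  local_restriction Lam phi l' <= restriction Lam phi l.
Proof. by move=> l'l; rewrite /restriction; exact: le_bigmax_cond. Qed.

Lemma restriction_le (R : realType) (L : finType) (W : Type)
    (Lam : L -> W -> \bar R) (phi : L -> L) (l : L) (x : \bar R) :
    (forall l', l' \in descendants phi l -> local_restriction Lam phi l' <= x) ->
  restriction Lam phi l <= x.
Proof. by move=> xP; apply: bigmax_le => //; exact: leNye. Qed.

Theorem proposition5p5 (R : realType) (L : finType) (W : Type)
    (Lam : L -> W -> \bar R) (phi : L -> L)
    (hLam : is_dissimilarity Lam) (hphi : is_parent_function phi) :
  is_restriction_function Lam phi (restriction Lam phi) /\
  (forall r : L -> \bar R, is_restriction_function Lam phi r ->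
     forall l : L, restriction Lam phi l <= r l).
Proof.
have local_le l : local_restriction Lam phi l <= restriction Lam phi l.
  exact/local_restriction_le_restriction/descendants_refl.
split; first split.
- by move=> l; apply: le_trans (local_le l); exact: local_restriction_ge0.
- move=> l w jump; apply: le_trans (local_le l).
  exact: le_jump_local_restriction.
- move=> l; apply: restriction_le => l' l'l.
  exact/local_restriction_le_restriction/descendants_parent.
- move=> l fix_l; apply/eqP; rewrite -leye_eq; apply: le_trans (local_le l).
  by rewrite /local_restriction fix_l eqxx.
- move=> r rP l; apply: restriction_le => l' l'l.
  apply: (@le_trans _ _ (r l')); first exact: local_restriction_le.
  exact: (restriction_function_descendants _ _ _ _ _ _ _ _ rP).
Qed.
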